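(* Let $\mathcal{A}$ be a central arrangement in $V=\mathbb{K}^\ell$, $H\in\mathcal{A}$, and let $M^p\subset\Omega^p(\mathcal{A}^H,\mathbf{k})$ be the image of $\mathbf{res}_H^p:\Omega^p(\mathcal{A})\to\Omega^p(\mathcal{A}^H,\mathbf{k})$. Then $$\sum_{p=0}^{\ell-1}P(M^p,x)\,y^p=\frac{x(1-x)}{x+y}\,\Phi(\mathcal{A};x,y),\qquad \Phi(\mathcal{A};x,y):=\sum_{p=0}^{\ell}P(\Omega^p(\mathcal{A}),x)\,y^p.$$
   Context: Notation as follows. $\mathbb{K}$ is a field of characteristic $0$, $S=\mathbb{K}[V^*]=\mathbb{K}[z_1,\dots,z_\ell]$ with $H=\{z_1=0\}$. For each hyperplane $H'$ fix a defining linear form $\alpha_{H'}$, $Q=\prod_{H'\in\mathcal{A}}\alpha_{H'}$, and $\Omega^p(\mathcal{A})=\{\omega\in\frac1Q\Omega^p_V: Q\frac{d\alpha_{H'}}{\alpha_{H'}}\wedge\omega\in\Omega^{p+1}_V\ \forall H'\in\mathcal{A}\}$. The restricted multiarrangement $(\mathcal{A}^H,\mathbf{k})$ on $H$ has hyperplanes $H'\cap H$ ($H'\ne H$) with multiplicity $\mathbf{k}(X)=\#\{H'\in\mathcal{A}\setminus\{H\}:H'\cap H=X\}$, and $\Omega^p(\mathcal{A}^H,\mathbf{k})=\{\omega\in\frac{1}{Q'}\Omega^p_H: Q'\frac{d\alpha_X}{\alpha_X^{\mathbf{k}(X)}}\wedge\omega\in\Omega^{p+1}_H\ \forall X\}$,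 $Q'=\prod_X\alpha_X^{\mathbf{k}(X)}$. Every $\omega\in\Omega^p(\mathcal{A})$ is uniquely $\omega_1+\frac{dz_1}{z_1}\wedge\omega_2$ with $\omega_1,\omega_2$ involving only $dz_2,\dots,dz_\ell$, and $\mathbf{res}^p_H(\omega)=\omega_1|_H$; $M^p$ is a graded $\mathbb{K}[H]=S/z_1S$-module. Grading convention: $\deg z_i=1$, $\deg dz_i=0$ (so e.g. $\frac1Q\Omega^\ell_V$ has lowest degree $-\#\mathcal{A}$). For a finitely generated graded module $M$, the Hilbert series is $P(M,x)=\sum_{p\in\mathbb{Z}}(\dim_\mathbb{K}M_p)x^p\in\mathbb{Z}[x^{-1}][[x]]$. *)

(* Defs.v *)
From mathcomp Require Import all_boot all_algebra.
From mathcomp Require Import mpoly.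
From Stdlib Require Import ClassicalEpsilon.

Set Implicit Arguments.
Unset Strict Implicit.
Unset Printing Implicit Defensive.

Import GRing.Theory.
Local Open Scope ring_scope.

Definition has_dim (K : fieldType) (V : lmodType K) (S : V -> Prop) (d : nat) :=
  exists v : 'I_d -> V,
    [/\ forall i, S (v i),
        forall c : 'I_d -> K, \sum_i c i *: v i = 0 -> forall i, c i = 0
      & forall x, S x -> exists c : 'I_d -> K, x = \sum_i c i *: v i].

(* dim_K S (meaningful when S is a finite-dimensional subspace) *)
Definition dimK (K : fieldType) (V : lmodType K) (S : V -> Prop) : nat :=
  epsilon (inhabits 0%N) (has_dim S).

(* Polynomial differential forms on V = K^l.                           *)
(* A form  sum_I f_I dz_I  is the finite function I |-> f_I, indexed   *)
(* by subsets I of {0,..,l-1} (dz_I = dz_{i1} /\ ... /\ dz_{ik},       *)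
(* i1 < ... < ik).  Coordinate z_1 of the paper is 'X_ord0 here.       *)
Definition form (K : fieldType) (l : nat) := {ffun {set 'I_l} -> {mpoly K[l]}}.

Definition pform (K : fieldType) (l : nat) (p : nat) (eta : form K l) :=
  forall I : {set 'I_l}, #|I| != p -> eta I = 0.

Definition linf (K : fieldType) (l : nat) (a : 'rV[K]_l) : {mpoly K[l]} :=
  \sum_(j < l) a 0 j *: 'X_j.

(* d(alpha) /\ eta, where d(alpha) = sum_j a_j dz_j *)
Definition wedge1 (K : fieldType) (l : nat) (a : 'rV[K]_l) (eta : form K l)
  : form K l :=
  [ffun J : {set 'I_l} =>
     \sum_(j in J) ((-1) ^+ #|[set i in J | (i < j)%N]| * a 0 j) *: eta (J :\ j)].

Definition homogf (K : fieldType) (l : nat) (d : int) (eta : form K l) :=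
  forall I, eta I = 0 \/ ((0 <= d) /\ eta I \is (absz d).-homog).

(* Central arrangements: a list of nonzero linear forms, pairwise      *)
(* non-proportional (so they define pairwise distinct hyperplanes).    *)
Definition central_arrangement (K : fieldType) (l : nat) (A : seq 'rV[K]_l) :=
  (forall a, a \in A -> a != 0) /\
  (forall i j : 'I_(size A), i != j ->
     forall c : K, nth 0 A i != c *: nth 0 A j).

(* Omega^p(A), represented via numerators: omega = eta / Q with
   Q = prod_{H' in A} alpha_{H'};  omega in Omega^p(A) iff eta is a p-form
   and for every H', Q (d alpha/alpha) /\ omega = (d alpha /\ eta)/alpha
   is a polynomial (p+1)-form. *)
Definition logform (K : fieldType) (l : nat) (A : seq 'rV[K]_l) (p : nat)
  (eta : form K l) :=
  pform p eta /\
  forall a, a \in A -> exists theta : form K l,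
    forall J, linf a * theta J = wedge1 a eta J.

(* graded piece of degree m of Omega^p(A):  deg(eta/Q) = deg eta - #A *)
Definition OmegaA_deg (K : fieldType) (l : nat) (A : seq 'rV[K]_l) (p : nat)
  (m : int) (eta : form K l) :=
  logform A p eta /\ homogf (m + (size A)%:Z) eta.

Definition restrH (K : fieldType) (l : nat) (q : {mpoly K[l.+1]}) : {mpoly K[l.+1]} :=
  q \mPo [tuple (if i == ord0 then 0 else 'X_i) | i < l.+1].

(* Residue.  H = {z_1 = 0} with alpha_H = c z_1.  For omega = eta/Q in
   Omega^p(A), omega_1 = eta_1/Q where eta_1 collects the dz_I with
   1 not in I; each such eta_I = z_1 q_I, hence
   res(omega) = omega_1|_H = (c^-1 q_I|_H)_I / Q''  with
   Q'' = prod_{H' <> H} alpha_{H'}|_H  (= Q' up to a nonzero scalar).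
   resnum c eta xi : xi is the numerator (over Q'') of res(eta/Q). *)
Definition resnum (K : fieldType) (l : nat) (c : K) (eta xi : form K l.+1) :=
  forall I : {set 'I_l.+1},
    if ord0 \in I then xi I = 0
    else exists q, eta I = 'X_ord0 * q /\ xi I = c^-1 *: restrH q.

(* graded piece of degree m of M^p = res(Omega^p(A)):
   xi/Q'' homogeneous of degree m, deg Q'' = #A - 1 *)
Definition Mres_deg (K : fieldType) (l : nat) (A : seq 'rV[K]_l.+1) (c : K)
  (p : nat) (m : int) (xi : form K l.+1) :=
  (exists eta, logform A p eta /\ resnum c eta xi) /\
  homogf (m + (size A)%:Z - 1) xi.

Definition hilbOmega (K : fieldType) (l : nat) (A : seq 'rV[K]_l) (p : nat)
  (m : int) : int := (dimK (OmegaA_deg A p m))%:Z.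

Definition hilbM (K : fieldType) (l : nat) (A : seq 'rV[K]_l.+1) (c : K)
  (p : nat) (m : int) : int := (dimK (Mres_deg A c p m))%:Z.

(* Formal series  sum_{p, m} F p m x^m y^p  with integer coefficients, *)
(* represented by their coefficient function.                          *)
Definition ser2 := nat -> int -> int.
Definition serX (F : ser2) : ser2 := fun p m => F p (m - 1).
Definition serY (F : ser2) : ser2 :=
  fun p m => if p is p'.+1 then F p' m else 0.
Definition serAdd (F G : ser2) : ser2 := fun p m => F p m + G p m.
Definition serSub (F G : ser2) : ser2 := fun p m => F p m - G p m.

(* sum_{p=0}^{l-1} P(M^p, x) y^p  for dim V = l = l'.+1 *)
Definition genM (K : fieldType) (l : nat) (A : seq 'rV[K]_l.+1) (c : K) : ser2 :=
  fun p m => if (p <= l)%N then hilbM A c p m else 0.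

Definition Phi (K : fieldType) (l : nat) (A : seq 'rV[K]_l) : ser2 :=
  fun p m => if (p <= l)%N then hilbOmega A p m else 0.

(* Main.v *)
(* Let [euler] be the contraction with the Euler field sum_j z_j d/dz_j.  Both
   [euler] and dz_1/z_1 /\ _ preserve logarithmic forms, and
     dz_1/z_1 /\ euler(omega) + euler(dz_1/z_1 /\ omega) = omega.
   Hence omega |-> (res omega, res (euler omega)) maps Omega^p(A)_m onto
   M^p_m (+) M^(p-1)_(m+1), since dz_1/z_1 /\ omega' is sent to (0, res omega').
   Its kernel is z_1 Omega^p(A)_(m-1): if res omega = 0, then already
   dz_1/z_1^2 /\ omega is logarithmic, so the displayed identity can be divided
   by z_1 when both residues vanish.  Counting dimensions gives the theorem. *)
From HB Require Import structures.
From mathcomp Require Import all_boot all_algebra.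
From mathcomp Require Import mpoly ring.
From Stdlib Require Import ClassicalEpsilon FunctionalExtensionality.
Require Import Defs.
Import GRing.Theory.

Set Implicit Arguments.
Unset Strict Implicit.
Unset Printing Implicit Defensive.

Local Open Scope ring_scope.

(** * Dimensions of subspaces given by predicates *)

Definition subspace (K : fieldType) (V : lmodType K) (S : V -> Prop) :=
  S 0 /\ forall (k : K) x y, S x -> S y -> S (k *: x + y).

Definition indep (K : fieldType) (V : lmodType K) (d : nat) (w : 'I_d -> V) :=
  forall c : 'I_d -> K, \sum_i c i *: w i = 0 -> forall i, c i = 0.

Lemma subspaceZ (K : fieldType) (V : lmodType K) (S : V -> Prop) k x :
  subspace S -> S x -> S (k *: x).
Proof. by case=> S0 SL Sx; rewrite -[_ *: x]addr0; apply: SL. Qed.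

Lemma subspaceD (K : fieldType) (V : lmodType K) (S : V -> Prop) x y :
  subspace S -> S x -> S y -> S (x + y).
Proof. by case=> S0 SL Sx Sy; rewrite -[x]scale1r; apply: SL. Qed.

Lemma subspaceB (K : fieldType) (V : lmodType K) (S : V -> Prop) x y :
  subspace S -> S x -> S y -> S (x - y).
Proof. by case=> S0 SL Sx Sy; rewrite addrC -scaleN1r; apply: SL. Qed.

Lemma subspace_sum (K : fieldType) (V : lmodType K) (S : V -> Prop) d
    (c : 'I_d -> K) (v : 'I_d -> V) :
  subspace S -> (forall i, S (v i)) -> S (\sum_i c i *: v i).
Proof.
move=> sS Sv; apply: (big_ind S) => [||i _]; first by case: sS.
- by move=> x y; apply: subspaceD.
- exact: subspaceZ.
Qed.

(** If [e > d], the coefficient matrix has more rows than columns, and a nonzero vector of its left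
    kernel is a linear relation among the [w i]. *)
Lemma indep_size_le (K : fieldType) (V : lmodType K) (d e : nat)
    (v : 'I_d -> V) (w : 'I_e -> V) :
  indep w -> (forall i, exists c : 'I_d -> K, w i = \sum_j c j *: v j) ->
  (e <= d)%N.
Proof.
move=> iw /fin_all_exists [C wE]; pose M := \matrix_(i < e, j < d) C i j.
rewrite leqNgt; apply/negP => lt_de.
have /rowV0Pn[u /sub_kermxP uM /eqP[]] : kermx M != 0.
  by rewrite kermx_eq0 /row_free neq_ltn (leq_ltn_trans (rank_leq_col M)).
apply/rowP => i; rewrite mxE; apply: (iw (fun i => u 0 i)) => {i}.
under eq_bigr => i _ do rewrite wE scaler_sumr.
rewrite exchange_big big1 // => j _ /=.
have /(congr1 (fun A : 'rV_d => A 0 j)) := uM.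
rewrite !mxE => uM0; rewrite -[RHS](scale0r (v j)) -uM0 scaler_suml.
by apply: eq_bigr => i _; rewrite mxE scalerA.
Qed.

Lemma has_dim_unique (K : fieldType) (V : lmodType K) (S : V -> Prop) d e :
  has_dim S d -> has_dim S e -> d = e.
Proof.
case=> v [Sv iv gv] [w [Sw iw gw]]; apply/eqP; rewrite eqn_leq; apply/andP.
by split; [apply: indep_size_le iv _ | apply: indep_size_le iw _] => i; auto.
Qed.

(** [dimK] is an epsilon choice, so uniqueness of the dimension is what lets any explicit basis
    compute it. *)
Lemma dimK_eq (K : fieldType) (V : lmodType K) (S : V -> Prop) d :
  has_dim S d -> dimK S = d.
Proof.
by move=> Sd; apply: (has_dim_unique _ Sd); apply: epsilon_spec; exists d.
Qed.

Lemma has_dim_ext (K : fieldType) (V : lmodType K) (S T : V -> Prop) d :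
  (forall x, S x <-> T x) -> has_dim S d -> has_dim T d.
Proof.
by move=> ST [v [Sv iv gv]]; exists v; split=> // [i|x /ST]; [apply/ST | apply: gv].
Qed.

Lemma has_dim0 (K : fieldType) (V : lmodType K) : has_dim (fun x : V => x = 0) 0.
Proof.
exists (fun=> 0); split=> [[] //|c _ [] //|x ->].
by exists (fun=> 0); rewrite big_ord0.
Qed.

(** The [v i] may lie outside [S]: they bound the size of independent families in [S], and one of
    maximal size is a basis. *)
Lemma has_dim_spanned (K : fieldType) (V : lmodType K) (S : V -> Prop) N
    (v : 'I_N -> V) :
  subspace S -> (forall x, S x -> exists c : 'I_N -> K, x = \sum_i c i *: v i) ->
  exists d, has_dim S d.
Proof.
move=> sS gv.
pose P k := exists w : 'I_k -> V, (forall i, S (w i)) /\ indep w.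
have [k [[w [Sw iw]] nPk]] : exists k, P k /\ ~ P k.+1.
  apply: NNPP => noP.
  have PS k : P k.
    elim: k => [|k Pk]; last by apply: NNPP => nPk; apply: noP; exists k.
    by exists (fun=> 0); split=> [[] //|c _ []].
  have [w [Sw iw]] := PS N.+1; suff: (N.+1 <= N)%N by rewrite ltnn.
  by apply: indep_size_le iw _ => i; apply: gv.
exists k, w; split=> // x Sx; apply: NNPP => ngx; apply: nPk.
exists (fun i => if unlift ord0 i is Some j then w j else x).
split=> [i|c]; first by case: unliftP.
rewrite big_ord_recl unlift_none.
under eq_bigr => i _ do rewrite liftK.
(* With zero coefficient at [x] the relation is one among the [w i]; otherwise it can be solved for
   [x], which was assumed outside their span. *)
move=> c0; have [c00|c0n] := eqVneq (c ord0) 0.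
  move: c0; rewrite c00 scale0r add0r => /iw ci i.
  by case: (unliftP ord0 i) => [j ->|->].
case: ngx; exists (fun i => - (c ord0)^-1 * c (lift ord0 i)).
under eq_bigr => i _ do rewrite -scalerA.
rewrite -scaler_sumr scaleNr -scalerN; move/eqP: c0.
by rewrite addr_eq0 => /eqP <-; rewrite scalerA mulVf // scale1r.
Qed.

(* Rank-nullity for a linear correspondence [R] from [S] onto [M]. *)
Lemma has_dim_exact (K : fieldType) (V W : lmodType K) (S T : V -> Prop)
    (M : W -> Prop) (R : V -> W -> Prop) d e :
  subspace S ->
  (forall k x x' y y', R x y -> R x' y' -> R (k *: x + x') (k *: y + y')) ->
  (forall x y y', R x y -> R x y' -> y = y') ->
  (forall x, S x -> exists2 y, M y & R x y) ->
  (forall y, M y -> exists2 x, S x & R x y) ->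
  (forall x, T x <-> S x /\ R x 0) ->
  has_dim T d -> has_dim M e -> has_dim S (d + e).
Proof.
move=> sS RL Rf Rt Rs TE [t [Tt it gt]] [y [My iy gy]].
have /fin_all_exists2[x Sx Rxy] : forall i, exists2 x, S x & R x (y i).
  by move=> i; apply: Rs.
have R0 : R 0 0.
  have [z _ R0z] := Rt 0 (proj1 sS).
  by have := RL (-1) _ _ _ _ R0z R0z; rewrite !scaleN1r addNr addNr.
have Rsum c : R (\sum_i c i *: x i) (\sum_i c i *: y i).
  apply: (big_rec2 R) => // i u1 u2 _ Ru; exact: RL.
(* The basis of [S] is the kernel basis [t] followed by the chosen lifts [x] of the basis [y] of
   [M]. *)
pose v i := match split i with inl a => t a | inr b => x b end.
have vl i : v (lshift e i) = t i by rewrite /v (unsplitK (inl _ i)).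
have vr i : v (rshift d i) = x i by rewrite /v (unsplitK (inr _ i)).
have St i : S (t i) by case: (proj1 (TE _) (Tt i)).
have Rt0 c : R (\sum_i c i *: t i) 0.
  apply: (big_ind (fun u => R u 0)) => // [u u' Ru Ru'|i _].
    by have := RL 1 _ _ _ _ Ru Ru'; rewrite scale1r scaler0 addr0.
  have [_ Ri] := proj1 (TE _) (Tt i).
  by have := RL (c i) _ _ _ _ Ri R0; rewrite scaler0 !addr0.
exists v; split=> [i|c|z Sz].
- by rewrite /v; case: split.
- rewrite big_split_ord /=.
  under eq_bigr do rewrite vl.
  under [X in _ + X]eq_bigr do rewrite vr.
  move=> c0.
  have yc : \sum_i c (rshift d i) *: y i = 0.
    have := RL 1 _ _ _ _ (Rt0 (c \o lshift e)) (Rsum (c \o @rshift d e)).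
    by rewrite scale1r /= c0 scaler0 add0r => /Rf; apply.
  have cr := iy _ yc.
  have cl i : c (lshift e i) = 0.
    apply: (it (c \o lshift e)); move: c0; rewrite [X in _ + X]big1 ?addr0 //.
    by move=> j _; rewrite cr scale0r.
  by move=> i; rewrite -[i]splitK; case: split.
- have [w Mw Rzw] := Rt z Sz; have [cy wE] := gy _ Mw.
  (* Subtracting from [z] the lift of its image leaves an element of the kernel. *)
  have /gt[ct tE] : T (z - \sum_i cy i *: x i).
    apply/TE; split; first by apply: subspaceB => //; apply: subspace_sum.
    have := RL (-1) _ _ _ _ (Rsum cy) Rzw.
    by rewrite -wE !scaleN1r addNr addrC.
  exists (fun i => match split i with inl a => ct a | inr b => cy b end).
  rewrite big_split_ord /= -[LHS](subrK (\sum_i cy i *: x i)) tE.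
  by congr (_ + _); apply: eq_bigr => i _;
    rewrite ?vl ?vr ?(unsplitK (inl _ i)) ?(unsplitK (inr _ i)).
Qed.

(** * Homogeneous components and restriction to the hyperplane *)

(** Degrees are integers because the numerator degree [m + #A] can be negative; such components are
    zero, in accordance with [homogf]. *)
Definition hcomp (K : fieldType) (n : nat) (d : int) (q : {mpoly K[n]}) :=
  if d is Posz k then pihomog mdeg k q else 0.

Lemma hcomp_is_linear (K : fieldType) (n : nat) (d : int) :
  linear (@hcomp K n d).
Proof.
by case: d => k c p q /=; [rewrite linearP | rewrite scaler0 addr0].
Qed.

HB.instance Definition _ (K : fieldType) (n : nat) (d : int) :=
  GRing.isLinear.Build K {mpoly K[n]} {mpoly K[n]} _ (@hcomp K n d)
    (@hcomp_is_linear K n d).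

Lemma hcompX (K : fieldType) (n : nat) (d : int) (m : 'X_{1..n}) :
  hcomp d ('X_[m] : {mpoly K[n]}) = if (mdeg m)%:Z == d then 'X_[m] else 0.
Proof. by case: d => k //=; rewrite pihomogX. Qed.

(** Checked on monomials; the case [d = -1] says that ['X_i * q] has no constant term. *)
Lemma hcompXM (K : fieldType) (n : nat) (d : int) (i : 'I_n)
    (q : {mpoly K[n]}) :
  hcomp (d + 1) ('X_i * q) = 'X_i * hcomp d q.
Proof.
elim/mpolyind: q => [|c m p _ _ IH]; first by rewrite mulr0 !linear0 mulr0.
rewrite mulrDr !linearD /= IH mulrDr -scalerAr !linearZ /= -scalerAr.
rewrite -mpolyXD !hcompX mdegD mdeg1 addnC PoszD (inj_eq (addIr _)).
by case: ifP => _; rewrite ?mulr0 ?mpolyXD.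
Qed.

Lemma homogfP (K : fieldType) (l : nat) (d : int) (eta : form K l) :
  homogf d eta <-> forall I, hcomp d (eta I) = eta I.
Proof.
split=> [h I|h I].
  case: (h I) => [->|[]]; first exact: linear0.
  by case: d h => // k _ _ /pihomog_dE.
case: d h => k /(_ I) /= h; last by left.
by right; split=> //; rewrite -h; apply: pihomogP.
Qed.

Lemma restrHX (K : fieldType) (l : nat) (m : 'X_{1..l.+1}) :
  restrH ('X_[m] : {mpoly K[l.+1]}) = if m ord0 == 0%N then 'X_[m] else 0.
Proof.
rewrite /restrH comp_mpolyX; case: eqP => [m0|/eqP m0].
  rewrite mpolyXE_id; apply: eq_bigr => i _; rewrite tnth_mktuple.
  by case: eqP => // ->; rewrite m0 !expr0.
by rewrite (bigD1 ord0) //= tnth_mktuple eqxx expr0n (negPf m0) mul0r.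
Qed.

Lemma restrH_is_linear (K : fieldType) (l : nat) : linear (@restrH K l).
Proof. by move=> c p q; rewrite /restrH linearP. Qed.

HB.instance Definition _ (K : fieldType) (l : nat) :=
  GRing.isLinear.Build K {mpoly K[l.+1]} {mpoly K[l.+1]} _ (@restrH K l)
    (@restrH_is_linear K l).

Lemma restrHM (K : fieldType) (l : nat) (p q : {mpoly K[l.+1]}) :
  restrH (p * q) = restrH p * restrH q.
Proof. by rewrite /restrH rmorphM. Qed.

Lemma restrHX0 (K : fieldType) (l : nat) :
  restrH ('X_ord0 : {mpoly K[l.+1]}) = 0.
Proof. by rewrite restrHX mnm1E eqxx. Qed.

Lemma hcomp_restrH (K : fieldType) (l : nat) (d : int) (q : {mpoly K[l.+1]}) :
  hcomp d (restrH q) = restrH (hcomp d q).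
Proof.
elim/mpolyind: q => [|c m p _ _ IH]; first by rewrite !linear0.
rewrite !linearD /= IH !linearZ /= restrHX hcompX.
congr (_ *: _ + _); case: ifP => m0; case: ifP => dm.
- by rewrite hcompX restrHX m0 dm.
- by rewrite hcompX dm linear0.
- by rewrite restrHX m0 linear0.
- by rewrite !linear0.
Qed.

(** A monomial either contains z_1 or is fixed by the restriction. Hence the kernel of [restrH] is
    the ideal generated by z_1. *)
Lemma restrH_decomp (K : fieldType) (l : nat) (q : {mpoly K[l.+1]}) :
  exists w, q = 'X_ord0 * w + restrH q.
Proof.
elim/mpolyind: q => [|c m p _ _ [w IH]].
  by exists 0; rewrite linear0 mulr0 addr0.
rewrite linearD linearZ /= restrHX; case: eqP => [_|/eqP m0].
  by exists w; rewrite addrCA -IH.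
exists (c *: 'X_[m - U_(ord0)] + w); rewrite mulrDr -addrA scaler0 add0r -IH.
by rewrite -scalerAr -mpolyXD addmC submK // lep1mP.
Qed.

Lemma restrH_eq0 (K : fieldType) (l : nat) (q : {mpoly K[l.+1]}) :
  restrH q = 0 -> exists w, q = 'X_ord0 * w.
Proof.
by move=> q0; have [w] := restrH_decomp q; rewrite q0 addr0; exists w.
Qed.

Lemma mulX_inj (K : fieldType) (n : nat) (i : 'I_n) :
  injective (fun q : {mpoly K[n]} => 'X_i * q).
Proof. by apply: mulfI; rewrite -msize_poly_eq0 msizeX. Qed.

Lemma linf_neq0 (K : fieldType) (l : nat) (a : 'rV[K]_l.+1) :
  (forall k, a != k *: delta_mx 0 ord0) -> restrH (linf a) != 0.
Proof.
move=> na; apply/eqP => r0; case/eqP: (na (a 0 ord0)).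
apply/rowP => j; rewrite !mxE eqxx /=; have [->|j0] := eqVneq j ord0.
  by rewrite mulr1.
rewrite mulr0; move/(congr1 (mcoeff U_(j))): r0.
rewrite /linf (linear_sum (@restrH K l)) raddf_sum mcoeff0 (bigD1 j) //= big1 ?addr0.
  rewrite linearZ /= restrHX mnm1E (negPf j0) /=.
  by rewrite mcoeffZ mcoeffXU eqxx mulr1.
move=> k kj; rewrite linearZ /= restrHX; case: ifP => _.
  by rewrite mcoeffZ mcoeffXU (negPf kj) mulr0.
by rewrite scaler0 mcoeff0.
Qed.

(** Restriction to H is a ring morphism into a domain which kills z_1 but not [linf a], so it must
    kill [v]. *)
Lemma linf_coprimeX0 (K : fieldType) (l : nat) (a : 'rV[K]_l.+1)
    (u v : {mpoly K[l.+1]}) :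
  (forall k, a != k *: delta_mx 0 ord0) -> 'X_ord0 * u = linf a * v ->
  exists w, v = 'X_ord0 * w.
Proof.
move=> na /(congr1 (@restrH K l)); rewrite !restrHM restrHX0 mul0r => /esym/eqP.
rewrite mulf_eq0 (negPf (linf_neq0 na)) /= => /eqP; exact: restrH_eq0.
Qed.

(** * Exterior calculus *)

(** The sign of moving dz_j past the dz_i with i < j in [J], as it occurs in [wedge1]. *)
Definition sgn (K : fieldType) (l : nat) (j : 'I_l) (J : {set 'I_l}) : K :=
  (-1) ^+ #|[set i in J | (i < j)%N]|.

Lemma sgnU1 (K : fieldType) (l : nat) (j k : 'I_l) (J : {set 'I_l}) :
  j \notin J -> sgn K k (j |: J) = (-1) ^+ (j < k)%N * sgn K k J.
Proof.
move=> jJ; rewrite /sgn -exprD; congr (_ ^+ _).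
have -> : [set i in j |: J | (i < k)%N] =
          [set i in [set j] | (i < k)%N] :|: [set i in J | (i < k)%N].
  by apply/setP => i; rewrite !inE andb_orl.
rewrite cardsU (_ : _ :&: _ = set0) ?cards0 ?subn0.
  congr addn; case: ltnP => jk.
    rewrite (_ : [set _ in _ | _] = [set j]) ?cards1 //.
    by apply/setP => i; rewrite !inE; case: eqP => // ->.
  apply/eqP; rewrite cards_eq0; apply/eqP/setP => i; rewrite !inE.
  by case: eqP => //= ->; rewrite ltnNge jk.
apply/setP => i; rewrite !inE; case: eqP => //= ->.
by rewrite (negPf jJ) andbF.
Qed.

Lemma sgnD1 (K : fieldType) (l : nat) (j k : 'I_l) (J : {set 'I_l}) :
  j \in J -> sgn K k J = (-1) ^+ (j < k)%N * sgn K k (J :\ j).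
Proof. by move=> jJ; rewrite -{1}(setD1K jJ) sgnU1 // !inE eqxx. Qed.

Lemma sgn_sqr (K : fieldType) (l : nat) (j : 'I_l) (J : {set 'I_l}) :
  sgn K j J * sgn K j J = 1.
Proof. by rewrite /sgn -expr2 sqrr_sign. Qed.

(** Exactly one of the two inequalities holds; this sign change cancels the mixed terms in the
    Cartan formula. *)
Lemma sgn_ltn (K : fieldType) (l : nat) (j k : 'I_l) :
  j != k -> (-1) ^+ (j < k)%N = - (-1) ^+ (k < j)%N :> K.
Proof. by rewrite -val_eqE /=; case: ltngtP => //= _ _; rewrite ?opprK. Qed.

Lemma wedge1E (K : fieldType) (l : nat) (a : 'rV[K]_l) (eta : form K l) J :
  wedge1 a eta J = \sum_(j in J) (sgn K j J * a 0 j) *: eta (J :\ j).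
Proof. by rewrite ffunE. Qed.

Lemma wedge1L (K : fieldType) (l : nat) (a : 'rV[K]_l) k (u v : form K l) J :
  wedge1 a (k *: u + v) J = k *: wedge1 a u J + wedge1 a v J.
Proof.
rewrite !wedge1E scaler_sumr -big_split.
by apply: eq_bigr => j _; rewrite !ffunE scalerDr !scalerA mulrC.
Qed.

Lemma wedge1_mul (K : fieldType) (l : nat) (a : 'rV[K]_l) q (u v : form K l) :
  (forall J, u J = q * v J) -> forall J, wedge1 a u J = q * wedge1 a v J.
Proof.
move=> uv J; rewrite !wedge1E mulr_sumr.
by apply: eq_bigr => j _; rewrite uv scalerAr.
Qed.

Lemma wedge1Z (K : fieldType) (l : nat) (a : 'rV[K]_l) c (u : form K l) J :
  wedge1 (c *: a) u J = c *: wedge1 a u J.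
Proof.
rewrite !wedge1E scaler_sumr; apply: eq_bigr => j _.
by rewrite mxE scalerA mulrCA.
Qed.

Lemma wedge1_delta (K : fieldType) (l : nat) (eta : form K l.+1) J :
  wedge1 (delta_mx 0 ord0) eta J = if ord0 \in J then eta (J :\ ord0) else 0.
Proof.
rewrite wedge1E; case: ifP => J0; last first.
  apply: big1 => j jJ; rewrite mxE eqxx /=; case: eqP => [j0|_].
    by rewrite -j0 jJ in J0.
  by rewrite mulr0 scale0r.
rewrite (bigD1 ord0) //= big1 ?addr0 => [|j /andP[_ /negPf j0]].
  rewrite mxE !eqxx mulr1 /sgn (_ : [set _ in _ | _] = set0).
    by rewrite cards0 expr0 scale1r.
  by apply/setP => i; rewrite !inE ltn0 andbF.
by rewrite mxE j0 andbF mulr0 scale0r.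
Qed.

(** Since dz_1 comes first in the ordering, removing it from [J] flips the sign attached to every
    other index. *)
Lemma wedge1_deltaC (K : fieldType) (l : nat) (a : 'rV[K]_l.+1)
    (eta : form K l.+1) J :
  wedge1 a (wedge1 (delta_mx 0 ord0) eta) J =
  - wedge1 (delta_mx 0 ord0) (wedge1 a eta) J.
Proof.
rewrite wedge1_delta; case: ifP => J0; last first.
  rewrite wedge1E oppr0 big1 // => j jJ.
  by rewrite wedge1_delta !inE J0 andbF scaler0.
rewrite !wedge1E -sumrN (bigD1 ord0) //= wedge1_delta !inE eqxx /= scaler0 add0r.
apply: eq_big => [j|j /andP[jJ j0]]; first by rewrite !inE andbC.
have sJ : sgn K j J = - sgn K j (J :\ ord0).
  by rewrite (sgnD1 K j J0) (_ : (ord0 < j)%N) ?lt0n // expr1 mulN1r.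
rewrite wedge1_delta !inE eq_sym j0 J0 /= sJ.
rewrite mulNr scaleNr; congr (- (_ *: eta _)).
by apply/setP => i; rewrite !inE andbCA.
Qed.

(** The coefficient of dz_J collects, for each j outside [J], the one of dz_(j |: J) with dz_j
    replaced by z_j, up to the sign of the position of j. *)
Definition euler (K : fieldType) (l : nat) (eta : form K l) : form K l :=
  [ffun J : {set 'I_l} => \sum_(j | j \notin J) sgn K j J *: ('X_j * eta (j |: J))].

Lemma eulerE (K : fieldType) (l : nat) (eta : form K l) J :
  euler eta J = \sum_(j | j \notin J) sgn K j J *: ('X_j * eta (j |: J)).
Proof. by rewrite ffunE. Qed.

Lemma euler0 (K : fieldType) (l : nat) : euler (0 : form K l) = 0.
Proof.
apply/ffunP => J; rewrite eulerE !ffunE big1 // => j _.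
by rewrite ffunE mulr0 scaler0.
Qed.

Lemma eulerL (K : fieldType) (l : nat) k (u v : form K l) :
  euler (k *: u + v) = k *: euler u + euler v.
Proof.
apply/ffunP => J; rewrite eulerE !ffunE scaler_sumr -big_split.
apply: eq_bigr => j _; rewrite !ffunE mulrDr scalerDr -scalerAr !scalerA.
by rewrite mulrC.
Qed.

Lemma euler_mul (K : fieldType) (l : nat) q (u v : form K l) :
  (forall J, u J = q * v J) -> forall J, euler u J = q * euler v J.
Proof.
move=> uv J; rewrite !eulerE mulr_sumr.
by apply: eq_bigr => j _; rewrite uv -scalerAr mulrCA.
Qed.

(* Cartan-type formula: contraction with the Euler field is an
   antiderivation, and it sends d(alpha) to alpha. *)
Lemma euler_wedge1 (K : fieldType) (l : nat) (a : 'rV[K]_l) (eta : form K l) J :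
  euler (wedge1 a eta) J + wedge1 a (euler eta) J = linf a * eta J.
Proof.
(* Separate the terms where the index inserted by the contraction is also the one removed by the
   wedge from the mixed terms. *)
have -> : euler (wedge1 a eta) J = \sum_(j | j \notin J) a 0 j *: 'X_j * eta J
    + \sum_(j | j \notin J) \sum_(k in J)
        (sgn K j J * sgn K k (j |: J) * a 0 k) *: ('X_j * eta ((j |: J) :\ k)).
  rewrite eulerE -big_split; apply: eq_bigr => j jJ /=.
  rewrite wedge1E (bigD1 j) ?setU11 //= setU1K // mulrDr scalerDr; congr (_ + _).
    rewrite -scalerAr scalerA sgnU1 // ltnn expr0 mul1r mulrA sgn_sqr mul1r.
    by rewrite scalerAl.
  rewrite mulr_sumr scaler_sumr; apply: eq_big => k.
    rewrite !inE andb_orl andbN /=; case: eqP => [->|_]; last by rewrite andbT.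
    by rewrite (negPf jJ).
  by move=> _; rewrite -scalerAr scalerA mulrA.
have -> : wedge1 a (euler eta) J = \sum_(j in J) a 0 j *: 'X_j * eta J
    + \sum_(k in J) \sum_(j | j \notin J)
        (sgn K k J * a 0 k * sgn K j (J :\ k)) *: ('X_j * eta (j |: (J :\ k))).
  rewrite wedge1E -big_split; apply: eq_bigr => k kJ /=.
  rewrite eulerE (bigD1 k) ?setD11 //= setD1K // scalerDr; congr (_ + _).
    rewrite scalerA mulrAC {1}(sgnD1 K k kJ) ltnn expr0 mul1r sgn_sqr mul1r.
    by rewrite scalerAl.
  rewrite scaler_sumr; apply: eq_big => j.
    rewrite !inE negb_and negbK; case: eqP => [->|_] /=; last by rewrite andbT.
    by rewrite kJ.
  by move=> _; rewrite scalerA.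
(* The mixed terms cancel in pairs: inserting j and removing k gives the same set in either order,
   with opposite signs. *)
rewrite addrACA [X in _ + X = _](_ : _ = 0) ?addr0; last first.
  rewrite [X in _ + X]exchange_big -big_split big1 //= => j jJ.
  rewrite -big_split big1 //= => k kJ.
  have jk : j != k by apply: contraNneq jJ => ->.
  have -> : (j |: J) :\ k = j |: J :\ k.
    apply/setP => i; rewrite !inE; case: (eqVneq i j) => [->|]; rewrite ?jk //.
  rewrite -scalerDl sgnU1 // (sgnD1 K j kJ) (sgn_ltn K jk).
  rewrite (_ : _ + _ = 0) ?scale0r //.
  by case: (k < j)%N; rewrite ?expr0 ?expr1; ring.
(* The diagonal terms with j outside [J] and those with j in [J] together make up
   [linf a * eta J]. *)
rewrite /linf mulr_suml [RHS](bigID (mem J)) /= addrC; congr (_ + _).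
Qed.

Lemma formN (K : fieldType) (l : nat) (u : form K l) J : (- u) J = - u J.
Proof. by rewrite ffunE. Qed.

Lemma formB (K : fieldType) (l : nat) (u v : form K l) J : (u - v) J = u J - v J.
Proof. by rewrite ffunE formN. Qed.

Definition hcompf (K : fieldType) (l : nat) (d : int) (eta : form K l) : form K l :=
  [ffun J => hcomp d (eta J)].

Lemma hcompf_wedge1 (K : fieldType) (l : nat) d (a : 'rV[K]_l) (eta : form K l) :
  hcompf d (wedge1 a eta) = wedge1 a (hcompf d eta).
Proof.
apply/ffunP => J; rewrite ffunE !wedge1E linear_sum.
by apply: eq_bigr => j _; rewrite linearZ ffunE.
Qed.

(** The contraction trades dz_j, of degree 0, for z_j, of degree 1. *)
Lemma hcompf_euler (K : fieldType) (l : nat) d (eta : form K l) :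
  hcompf (d + 1) (euler eta) = euler (hcompf d eta).
Proof.
apply/ffunP => J; rewrite ffunE !eulerE linear_sum.
by apply: eq_bigr => j _; rewrite linearZ ffunE /= hcompXM.
Qed.

Lemma hcomp_linf (K : fieldType) (l : nat) d (a : 'rV[K]_l) q :
  hcomp (d + 1) (linf a * q) = linf a * hcomp d q.
Proof.
rewrite /linf !mulr_suml linear_sum; apply: eq_bigr => j _ /=.
by rewrite -!scalerAl linearZ /= hcompXM.
Qed.

Lemma homogf_hcompf (K : fieldType) (l : nat) (d : int) (eta : form K l) :
  homogf d eta <-> hcompf d eta = eta.
Proof.
split=> [/homogfP h|h]; first by apply/ffunP => I; rewrite ffunE.
by apply/homogfP => I; rewrite -{2}h ffunE.
Qed.

Lemma homogf_hcomp (K : fieldType) (l : nat) d (eta : form K l) :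
  homogf d (hcompf d eta).
Proof.
apply/homogfP => I; rewrite ffunE; case: d => k /=; last by [].
exact: pihomog_id.
Qed.

Lemma homogf_subspace (K : fieldType) (l : nat) d : subspace (@homogf K l d).
Proof.
split; first by move=> I; left; rewrite ffunE.
move=> k x y /homogfP hx /homogfP hy; apply/homogfP => I.
by rewrite !ffunE linearP /= hx hy.
Qed.

Lemma homogf_euler (K : fieldType) (l : nat) d (eta : form K l) :
  homogf d eta -> homogf (d + 1) (euler eta).
Proof. by move/homogf_hcompf => h; apply/homogf_hcompf; rewrite hcompf_euler h. Qed.

Lemma homogf_wedge1 (K : fieldType) (l : nat) d (a : 'rV[K]_l) (eta : form K l) :
  homogf d eta -> homogf d (wedge1 a eta).
Proof.
by move/homogf_hcompf => h; apply/homogf_hcompf; rewrite hcompf_wedge1 h.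
Qed.

Lemma homogf_mulX (K : fieldType) (l : nat) d i (u v : form K l) :
  (forall J, u J = 'X_i * v J) -> homogf (d + 1) u <-> homogf d v.
Proof.
move=> uv; split=> /homogfP h; apply/homogfP => J; last first.
  by rewrite uv hcompXM h.
by apply: (@mulX_inj _ _ i); rewrite /= -hcompXM -uv.
Qed.

(** The monomial forms z^m dz_I with m of degree at most [absz d] are finite in number and span all
    forms satisfying [homogf d]. *)
Lemma has_dim_homogf (K : fieldType) (l : nat) d (S : form K l -> Prop) :
  subspace S -> (forall x, S x -> homogf d x) -> exists k, has_dim S k.
Proof.
move=> sS Sd.
pose T : finType := ({set 'I_l} * 'X_{1..l < (absz d).+1})%type.
pose b (t : T) : form K l :=
  [ffun J => if J == t.1 then 'X_[t.2] else 0].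
pose c (x : form K l) (t : T) := (x t.1)@_(t.2).
apply: (@has_dim_spanned _ _ S #|T| (b \o enum_val)) => // x /Sd hx.
exists (c x \o enum_val).
rewrite -(big_enum_val (fun t : T => c x t *: b t)) /=.
apply/ffunP => J; rewrite sum_ffunE 
  -(pair_bigA _ (fun I m => (c x (I, m) *: b (I, m)) J)) /=.
rewrite (bigD1 J) //= [X in _ + X]big1 ?addr0; last first.
  move=> I IJ; rewrite big1 // => m _.
  by rewrite !ffunE /= eq_sym (negPf IJ) scaler0.
under eq_bigr => m _ do rewrite !ffunE /= eqxx.
apply: mpolywE; case: (hx J) => [->|[_ /dhomogP h]]; first by rewrite msize0.
by rewrite msizeE; apply/bigmax_leqP_seq => m /h ->.
Qed.

(** * Logarithmic forms *)

Lemma form_divX0 (K : fieldType) (l : nat) (u : form K l.+1) :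
  (forall J, exists q, u J = 'X_ord0 * q) ->
  exists v : form K l.+1, forall J, u J = 'X_ord0 * v J.
Proof.
by move=> /fin_all_exists[f uf]; exists [ffun J => f J] => J; rewrite ffunE.
Qed.

Lemma linfZdelta (K : fieldType) (l : nat) (c : K) :
  linf (c *: delta_mx 0 ord0) = c *: 'X_ord0 :> {mpoly K[l.+1]}.
Proof.
rewrite /linf (bigD1 ord0) //= big1 ?addr0 => [|j /negPf j0]; rewrite !mxE.
  by rewrite eqxx mulr1.
by rewrite j0 mulr0 scale0r.
Qed.

(** The forms in [A] are pairwise non-proportional, so only the chosen equation of H is a multiple
    of z_1. *)
Lemma central_notZdelta (K : fieldType) (l : nat) (A : seq 'rV[K]_l.+1) c a :
  central_arrangement A -> c != 0 -> c *: delta_mx 0 ord0 \in A ->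
  a \in A -> a != c *: delta_mx 0 ord0 -> forall k, a != k *: delta_mx 0 ord0.
Proof.
move=> [_ Anp] c0 HA aA aH k; set h := c *: _ in HA aH.
have ia : (index a A < size A)%N by rewrite index_mem.
have ih : (index h A < size A)%N by rewrite index_mem.
have := Anp (Ordinal ia) (Ordinal ih); rewrite /= !nth_index //.
rewrite -val_eqE /= => /(_ _ (k / c)); rewrite scalerA mulfVK //; apply.
by apply: contraNneq aH => /(congr1 (nth 0 A)); rewrite !nth_index // => ->.
Qed.

(** This is [logform] without the form degree, so that it can be carried along operators that change
    that degree. *)
Definition logcond (K : fieldType) (l : nat) (A : seq 'rV[K]_l) (eta : form K l) :=
  forall a, a \in A -> exists theta : form K l,
    forall J, linf a * theta J = wedge1 a eta J.

Lemma logcond_subspace (K : fieldType) (l : nat) (A : seq 'rV[K]_l) :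
  subspace (logcond A).
Proof.
split=> [a _|k x y hx hy a aA].
  exists 0 => J; rewrite ffunE mulr0 wedge1E big1 // => j _.
  by rewrite ffunE scaler0.
have [[t tE] [s sE]] := (hx a aA, hy a aA).
exists (k *: t + s) => J; rewrite wedge1L -tE -sE !ffunE mulrDr.
by rewrite -scalerAr.
Qed.

Lemma logcond_mul (K : fieldType) (l : nat) (A : seq 'rV[K]_l) q (u v : form K l) :
  (forall J, u J = q * v J) -> logcond A v -> logcond A u.
Proof.
move=> uv hv a /hv[t tE]; exists [ffun J => q * t J] => J.
by rewrite ffunE (wedge1_mul a uv) -tE mulrCA.
Qed.

(** Contracting d(alpha) /\ eta = alpha theta, the Cartan formula gives d(alpha) /\ euler(eta) =
    alpha (eta - euler(theta)). *)
Lemma logcond_euler (K : fieldType) (l : nat) (A : seq 'rV[K]_l) (eta : form K l) :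
  logcond A eta -> logcond A (euler eta).
Proof.
move=> hA a /hA[t tE]; exists (eta - euler t) => J.
have /(_ J) := @euler_mul K l (linf a) (wedge1 a eta) t (fun J => esym (tE J)).
have := euler_wedge1 a eta J => /[swap] ->; rewrite formB mulrBr => <-.
by rewrite addrC addKr.
Qed.

Lemma logcond_wedge1_delta (K : fieldType) (l : nat) (A : seq 'rV[K]_l.+1)
    (eta : form K l.+1) :
  logcond A eta -> logcond A (wedge1 (delta_mx 0 ord0) eta).
Proof.
move=> hA a /hA[t tE]; exists (- wedge1 (delta_mx 0 ord0) t) => J.
rewrite wedge1_deltaC formN mulrN; congr (- _).
by rewrite -(@wedge1_mul _ _ _ (linf a) (wedge1 a eta) t).
Qed.

(** At H, dz_1 /\ v vanishes because z_1 times it does. At another hyperplane alpha is prime to z_1,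
    so z_1 divides the quotient theta of [u]. *)
Lemma logcond_divX0 (K : fieldType) (l : nat) (A : seq 'rV[K]_l.+1) c
    (u v : form K l.+1) :
  central_arrangement A -> c != 0 -> c *: delta_mx 0 ord0 \in A ->
  (forall J, u J = 'X_ord0 * v J) ->
  (forall J, wedge1 (delta_mx 0 ord0) u J = 0) -> logcond A u -> logcond A v.
Proof.
move=> cA c0 HA uv u0 hu a aA; have [aH|aH] := eqVneq a (c *: delta_mx 0 ord0).
  exists 0 => J; rewrite ffunE mulr0 aH wedge1Z; apply: (@mulX_inj _ _ ord0) => /=.
  by rewrite -scalerAr -(wedge1_mul (delta_mx 0 ord0) uv) u0 scaler0 mulr0.
have [t tE] := hu a aA.
have na := central_notZdelta cA c0 HA aA aH.
have [s sE] : exists s : form K l.+1, forall J, t J = 'X_ord0 * s J.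
  apply: form_divX0 => J; apply: (linf_coprimeX0 (u := wedge1 a v J) na).
  by rewrite tE (wedge1_mul a uv).
exists s => J; apply: (@mulX_inj _ _ ord0) => /=.
by rewrite mulrCA -sE tE (wedge1_mul a uv).
Qed.

(** The coefficient of dz_1 /\ eta at [ord0 |: I] is [eta I], and the condition at H makes it a
    multiple of z_1. *)
Lemma logcond_dvdX0 (K : fieldType) (l : nat) (A : seq 'rV[K]_l.+1) c
    (eta : form K l.+1) (I : {set 'I_l.+1}) :
  c != 0 -> c *: delta_mx 0 ord0 \in A -> logcond A eta -> ord0 \notin I ->
  exists q, eta I = 'X_ord0 * q.
Proof.
move=> c0 HA /(_ _ HA)[t tE] I0; exists (t (ord0 |: I)).
have := tE (ord0 |: I); rewrite linfZdelta wedge1Z wedge1_delta setU11 setU1K //.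
by rewrite -scalerAl => /(scalerI c0).
Qed.

Lemma wedge1_delta2 (K : fieldType) (l : nat) (eta : form K l.+1) J :
  wedge1 (delta_mx 0 ord0) (wedge1 (delta_mx 0 ord0) eta) J = 0.
Proof. by rewrite !wedge1_delta !inE eqxx /= if_same. Qed.

(* The operator omega |-> dz_1/z_1 /\ omega. *)
Lemma logcond_dlog (K : fieldType) (l : nat) (A : seq 'rV[K]_l.+1) c
    (eta : form K l.+1) :
  central_arrangement A -> c != 0 -> c *: delta_mx 0 ord0 \in A ->
  logcond A eta ->
  exists2 u, logcond A u &
    forall J, wedge1 (delta_mx 0 ord0) eta J = 'X_ord0 * u J.
Proof.
move=> cA c0 HA hA.
have [|u uE] := @form_divX0 K l (wedge1 (delta_mx 0 ord0) eta).
  move=> J; rewrite wedge1_delta; case: ifP => J0; last by exists 0; rewrite mulr0.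
  by apply: (logcond_dvdX0 c0 HA) => //; rewrite !inE eqxx.
exists u => //; apply: (logcond_divX0 cA c0 HA uE).
  exact: wedge1_delta2.
exact: logcond_wedge1_delta.
Qed.

(** The coefficients of dz_1 /\ eta are the [eta I] with 1 not in I. A zero residue makes them
    divisible by z_1 a second time, and the quotient is still killed by dz_1, hence logarithmic. *)
Lemma logcond_dlog_divX0 (K : fieldType) (l : nat) (A : seq 'rV[K]_l.+1) c
    (eta : form K l.+1) :
  central_arrangement A -> c != 0 -> c *: delta_mx 0 ord0 \in A ->
  logcond A eta -> resnum c eta 0 ->
  exists2 u, logcond A u &
    forall J, wedge1 (delta_mx 0 ord0) eta J = 'X_ord0 * ('X_ord0 * u J).
Proof.
move=> cA c0 HA hA r0; have [v hv vE] := logcond_dlog cA c0 HA hA.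
have [|u uE] := @form_divX0 K l v.
  move=> J; have := vE J; rewrite wedge1_delta; case: ifP => J0; last first.
    rewrite -(mulr0 'X_ord0) => /mulX_inj <-; exists 0; by rewrite mulr0.
  have := r0 (J :\ ord0); rewrite !inE eqxx /= => -[q [-> q0]] /mulX_inj <-.
  apply: restrH_eq0; move/esym/eqP: q0.
  by rewrite ffunE scaler_eq0 invr_eq0 (negPf c0) /= => /eqP.
exists u; last by move=> J; rewrite vE uE.
apply: (logcond_divX0 cA c0 HA uE) => // J; apply: (@mulX_inj _ _ ord0).
by rewrite /= -(wedge1_mul (delta_mx 0 ord0) vE) wedge1_delta2 mulr0.
Qed.

Lemma logcond_hcompf (K : fieldType) (l : nat) (A : seq 'rV[K]_l) d
    (eta : form K l) :
  logcond A eta -> logcond A (hcompf d eta).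
Proof.
(* The quotient is taken in degree [d - 1] because alpha has degree 1. *)
move=> hA a /hA[t tE]; exists (hcompf (d - 1) t) => J.
by rewrite -hcompf_wedge1 ![hcompf _ _ J]ffunE -hcomp_linf subrK tE.
Qed.

(** * Residues *)

Lemma resnumL (K : fieldType) (l : nat) (c k : K) (x x' y y' : form K l.+1) :
  resnum c x y -> resnum c x' y' -> resnum c (k *: x + x') (k *: y + y').
Proof.
move=> r r' I; have := (r I, r' I); case: ifP.
  by move=> _ [yI y'I]; rewrite !ffunE yI y'I scaler0 addr0.
move=> _ [[q [xq yq]] [q' [xq' yq']]].
exists (k *: q + q'); rewrite !ffunE xq xq' yq yq' mulrDr -scalerAr; split=> //.
by rewrite linearP scalerDr !scalerA mulrC.
Qed.

Lemma resnum00 (K : fieldType) (l : nat) (c : K) : resnum c (0 : form K l.+1) 0.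
Proof.
move=> I; rewrite !ffunE; case: ifP => // _.
by exists 0; rewrite mulr0 linear0 scaler0.
Qed.

Lemma resnum_fun (K : fieldType) (l : nat) (c : K) (x y y' : form K l.+1) :
  resnum c x y -> resnum c x y' -> y = y'.
Proof.
move=> r r'; apply/ffunP => I; have := (r I, r' I); case: ifP => _ [].
  by move=> -> ->.
by move=> [q [-> ->]] [q' [/mulX_inj -> ->]].
Qed.

Lemma resnum_ext (K : fieldType) (l : nat) (c : K) (x x' y : form K l.+1) :
  (forall I : {set 'I_l.+1}, ord0 \notin I -> x I = x' I) ->
  resnum c x y -> resnum c x' y.
Proof.
by move=> xx r I; have := r I; case: ifP => // I0; rewrite xx ?I0.
Qed.

Lemma resnum_hcompf (K : fieldType) (l : nat) (c : K) d (x y : form K l.+1) :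
  resnum c x y -> resnum c (hcompf (d + 1) x) (hcompf d y).
Proof.
move=> r I; have := r I; rewrite !ffunE; case: ifP => _.
  by move=> ->; exact: linear0.
move=> [q [-> ->]]; exists (hcomp d q); rewrite hcompXM; split=> //.
by rewrite linearZ /= hcomp_restrH.
Qed.

Lemma resnum_homogf (K : fieldType) (l : nat) (c : K) d (x y : form K l.+1) :
  resnum c x y -> homogf (d + 1) x -> homogf d y.
Proof.
move=> r /homogf_hcompf hx; apply/homogf_hcompf.
by have := resnum_hcompf d r; rewrite hx => /resnum_fun; apply.
Qed.

Lemma resnum_total (K : fieldType) (l : nat) (A : seq 'rV[K]_l.+1) c
    (eta : form K l.+1) :
  c != 0 -> c *: delta_mx 0 ord0 \in A -> logcond A eta ->
  exists xi, resnum c eta xi.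
Proof.
move=> c0 HA hA.
have /fin_all_exists[f fE] : forall I : {set 'I_l.+1}, exists q,
    if ord0 \in I then q = 0 else eta I = 'X_ord0 * q.
  move=> I; case I0: (ord0 \in I); first by exists 0.
  by apply: (logcond_dvdX0 c0 HA hA); rewrite I0.
exists [ffun I => c^-1 *: restrH (f I)] => I; rewrite ffunE.
have := fE I; case: ifP => _; first by move=> ->; rewrite linear0 scaler0.
by exists (f I).
Qed.

Lemma resnum_mulX0 (K : fieldType) (l : nat) (A : seq 'rV[K]_l.+1) c
    (x y : form K l.+1) :
  c != 0 -> c *: delta_mx 0 ord0 \in A -> logcond A x ->
  (forall J, y J = 'X_ord0 * x J) -> resnum c y 0.
Proof.
move=> c0 HA hx yx I; rewrite ffunE; case: ifP => // I0; exists (x I).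
split=> //; have [|q ->] := logcond_dvdX0 c0 HA hx (I := I); first by rewrite I0.
by rewrite restrHM restrHX0 mul0r scaler0.
Qed.

(** By the Cartan formula z_1 euler(u) = z_1 b - dz_1 /\ euler(b), so [euler u] and [b] agree on all
    coefficients without dz_1, the only ones the residue sees. *)
Lemma resnum_euler_dlog (K : fieldType) (l : nat) (c : K) (b u y : form K l.+1) :
  (forall J, wedge1 (delta_mx 0 ord0) b J = 'X_ord0 * u J) ->
  resnum c b y -> resnum c (euler u) y.
Proof.
move=> bu; apply: resnum_ext => I I0; apply: (@mulX_inj _ _ ord0).
have := euler_wedge1 (delta_mx 0 ord0) b I; rewrite (euler_mul bu).
rewrite wedge1_delta (negPf I0) addr0 => ->.
by rewrite -[delta_mx 0 ord0]scale1r linfZdelta scale1r.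
Qed.

(** * Graded pieces of the residue modules *)

Definition vanish (K : fieldType) (l : nat) (P : pred {set 'I_l}) (eta : form K l) :=
  forall I, P I -> eta I = 0.

Lemma vanish_subspace (K : fieldType) (l : nat) (P : pred {set 'I_l}) :
  subspace (@vanish K l P).
Proof.
split=> [I _|k x y hx hy I PI]; first by rewrite ffunE.
by rewrite !ffunE hx ?hy // scaler0 addr0.
Qed.

Lemma vanish_mulX0 (K : fieldType) (l : nat) (P : pred {set 'I_l.+1})
    (x y : form K l.+1) :
  (forall J, y J = 'X_ord0 * x J) -> vanish P y -> vanish P x.
Proof.
by move=> yx hy I PI; apply: (@mulX_inj _ _ ord0); rewrite /= -yx hy // mulr0.
Qed.

(** A predicate [P] replaces the form degree: one definition then covers M^p, where it unfolds to
    [Mres_deg], and M^(p-1), including p = 0. *)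
Definition residue_deg (K : fieldType) (l : nat) (A : seq 'rV[K]_l.+1) (c : K)
    (P : pred {set 'I_l.+1}) (m : int) (xi : form K l.+1) :=
  (exists eta, (vanish P eta /\ logcond A eta) /\ resnum c eta xi) /\
  homogf (m + (size A)%:Z - 1) xi.

(** Logarithmic forms are closed under taking homogeneous components and the residue respects these,
    so any lift may be replaced by its component of the right degree. *)
Lemma residue_deg_lift (K : fieldType) (l : nat) (A : seq 'rV[K]_l.+1) (c : K)
    P m (xi : form K l.+1) :
  residue_deg A c P m xi ->
  exists eta, [/\ vanish P eta, logcond A eta, homogf (m + (size A)%:Z) eta
                & resnum c eta xi].
Proof.
case=> -[eta [[Pe le] re]] /homogf_hcompf hxi.
exists (hcompf (m + (size A)%:Z) eta); split.
- by move=> I PI; rewrite ffunE Pe // linear0.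
- exact: logcond_hcompf.
- exact: homogf_hcomp.
- by have := resnum_hcompf (m + (size A)%:Z - 1) re; rewrite subrK hxi.
Qed.

Lemma residue_deg_subspace (K : fieldType) (l : nat) (A : seq 'rV[K]_l.+1) (c : K)
    P m :
  subspace (residue_deg A c P m).
Proof.
have [sv sl] := (@vanish_subspace K _ P, logcond_subspace A).
have sh := homogf_subspace K l.+1 (m + (size A)%:Z - 1).
split=> [|k x y [[u [[Pu lu] ru]] hx] [[v [[Pv lv] rv]] hy]]; split.
- exists 0; split; first by split; [apply: (proj1 sv) | apply: (proj1 sl)].
  exact: resnum00.
- exact: (proj1 sh).
- exists (k *: u + v); split; last exact: resnumL.
  by split; [apply: (proj2 sv) | apply: (proj2 sl)].
- exact: (proj2 sh).
Qed.

Lemma OmegaA_subspace (K : fieldType) (l : nat) (A : seq 'rV[K]_l) p m :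
  subspace (OmegaA_deg A p m).
Proof.
have sv := @vanish_subspace K l (fun I => #|I| != p).
have sl := logcond_subspace A; have sh := homogf_subspace K l (m + (size A)%:Z).
split=> [|k x y [[px lx] hx] [[py ly] hy]].
  by split; [split; [apply: (proj1 sv) | apply: (proj1 sl)] | apply: (proj1 sh)].
split; last exact: (proj2 sh).
by split; [apply: (proj2 sv) | apply: (proj2 sl)].
Qed.

(* Vanishing on this predicate means being a (p-1)-form; for p = 0, being zero. *)
Notation not_predegree p := (fun I : {set 'I__} => #|I|.+1 != p).

Lemma pform_euler (K : fieldType) (l p : nat) (eta : form K l) :
  pform p eta -> vanish (not_predegree p) (euler eta).
Proof.
move=> pe I Ip; rewrite eulerE big1 // => j jI.
by rewrite pe ?mulr0 ?scaler0 // cardsU1 jI.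
Qed.

Lemma pform_wedge1_delta (K : fieldType) (l p : nat) (eta : form K l.+1) :
  vanish (not_predegree p) eta -> pform p (wedge1 (delta_mx 0 ord0) eta).
Proof.
move=> pe J Jp; rewrite wedge1_delta; case: ifP => // J0.
by apply: pe; move: Jp; rewrite (cardsD1 ord0 J) J0.
Qed.

(** * Kernels of the two residues and the dimension count *)

Definition kerres (K : fieldType) (l : nat) (A : seq 'rV[K]_l.+1) (c : K) p m
    (x : form K l.+1) := OmegaA_deg A p m x /\ resnum c x 0.

Definition kerres2 (K : fieldType) (l : nat) (A : seq 'rV[K]_l.+1) (c : K) p m
    (x : form K l.+1) := kerres A c p m x /\ resnum c (euler x) 0.

Lemma resnumL0 (K : fieldType) (l : nat) (c k : K) (x y : form K l.+1) :
  resnum c x 0 -> resnum c y 0 -> resnum c (k *: x + y) 0.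
Proof. by move=> rx ry; have := resnumL k rx ry; rewrite scaler0 addr0. Qed.

Lemma kerres_subspace (K : fieldType) (l : nat) (A : seq 'rV[K]_l.+1) (c : K) p m :
  subspace (kerres A c p m).
Proof.
have [O0 OL] := OmegaA_subspace A p m.
split=> [|k x y [Ox rx] [Oy ry]]; split=> //.
- exact: resnum00.
- exact: OL.
- exact: resnumL0.
Qed.

Lemma kerres2_subspace (K : fieldType) (l : nat) (A : seq 'rV[K]_l.+1) (c : K) p m :
  subspace (kerres2 A c p m).
Proof.
have [O0 OL] := kerres_subspace A c p m.
split=> [|k x y [Ox rx] [Oy ry]]; split=> //.
- by rewrite euler0; apply: resnum00.
- exact: OL.
- by rewrite eulerL; apply: resnumL0.
Qed.

(** The coefficients of [x] and [euler x] without dz_1 are already divisible by z_1; another factor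
    z_1 makes both residues vanish on H. *)
Lemma kerres2_mulX0 (K : fieldType) (l : nat) (A : seq 'rV[K]_l.+1) (c : K) p m
    (x y : form K l.+1) :
  c != 0 -> c *: delta_mx 0 ord0 \in A ->
  (forall J, y J = 'X_ord0 * x J) -> OmegaA_deg A p (m - 1) x ->
  kerres2 A c p m y.
Proof.
move=> c0 HA yx [[px lx] hx].
split; last exact: (resnum_mulX0 c0 HA (logcond_euler lx) (euler_mul yx)).
split; last exact: (resnum_mulX0 c0 HA lx yx).
split; first split.
- by move=> I Ip; rewrite yx px // mulr0.
- exact: (logcond_mul yx).
- have -> : m + (size A)%:Z = m - 1 + (size A)%:Z + 1 by ring.
  exact/(homogf_mulX _ yx).
Qed.

(* Dividing z_1 eta = dz_1 /\ euler eta + euler (dz_1 /\ eta) by z_1^2. *)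
Lemma kerres2_divX0 (K : fieldType) (l : nat) (A : seq 'rV[K]_l.+1) (c : K) p m
    (y : form K l.+1) :
  central_arrangement A -> c != 0 -> c *: delta_mx 0 ord0 \in A ->
  kerres2 A c p m y ->
  exists2 x, OmegaA_deg A p (m - 1) x & forall J, y J = 'X_ord0 * x J.
Proof.
move=> cA c0 HA [[[[py ly] hy] ry] riy].
have [u lu uE] := logcond_dlog_divX0 cA c0 HA ly ry.
have [v lv vE] := logcond_dlog_divX0 cA c0 HA (logcond_euler ly) riy.
(* Here dz_1 /\ y = z_1^2 u and dz_1 /\ euler(y) = z_1^2 v; cancelling one z_1 in the formula leaves
   y = z_1 (euler(u) + v). *)
have yE J : y J = 'X_ord0 * (euler u + v) J.
  apply: (@mulX_inj _ _ ord0) => /=.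
  have := euler_wedge1 (delta_mx 0 ord0) y J.
  rewrite -{3}[delta_mx 0 ord0]scale1r linfZdelta scale1r vE => <-.
  rewrite (@euler_mul _ _ ('X_ord0 * 'X_ord0) _ u) => [|I]; last by rewrite uE mulrA.
  by rewrite [(euler u + v) J]ffunE !mulrDr !mulrA.
exists (euler u + v) => //; split; first split.
- exact: (vanish_mulX0 yE).
- by apply: subspaceD (logcond_subspace A) _ lv; apply: logcond_euler.
- apply/(homogf_mulX _ yE).
  by rewrite (_ : _ + 1 = m + (size A)%:Z) //; ring.
Qed.

(** Rank-nullity is applied three times: to the residue, to the residue of [euler] on its kernel,
    and to multiplication by z_1 onto the remaining kernel. The shift [m + 1] comes from [euler]
    raising the degree. *)
Lemma dimK_OmegaA (K : fieldType) (l : nat) (A : seq 'rV[K]_l.+1) (c : K) p m :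
  central_arrangement A -> c != 0 -> c *: delta_mx 0 ord0 \in A ->
  dimK (OmegaA_deg A p m) =
  (dimK (OmegaA_deg A p (m - 1)) + dimK (residue_deg A c (not_predegree p) (m + 1))
   + dimK (Mres_deg A c p m))%N.
Proof.
move=> cA c0 HA.
have [d1 D1] : exists d, has_dim (kerres A c p m) d.
  by apply: (has_dim_homogf (kerres_subspace A c p m)) => x [[]]; eauto.
have [d2 D2] : exists d, has_dim (kerres2 A c p m) d.
  by apply: (has_dim_homogf (kerres2_subspace A c p m)) => x [[[]]]; eauto.
have [d3 D3] : exists d, has_dim (Mres_deg A c p m) d.
  by apply: (has_dim_homogf (residue_deg_subspace A c _ m)) => x []; eauto.
have [d4 D4] : exists d, has_dim (residue_deg A c (not_predegree p) (m + 1)) d.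
  by apply: (has_dim_homogf (residue_deg_subspace A c _ _)) => x []; eauto.
have E1 : has_dim (OmegaA_deg A p m) (d1 + d3).
  apply: (has_dim_exact (R := resnum c)) D1 D3 => //.
  - exact: OmegaA_subspace.
  - by move=> *; apply: resnumL.
  - by move=> x y y'; apply: resnum_fun.
  - move=> x [[px lx] hx]; have [y rxy] := resnum_total c0 HA lx.
    exists y => //; split; first by exists x.
    by apply: (resnum_homogf rxy); rewrite subrK.
  - move=> y /(@residue_deg_lift _ _ _ _ (fun I => #|I| != p))[x [px lx hx rxy]].
    by exists x.
have E2 : has_dim (kerres A c p m) (d2 + d4).
  apply: (has_dim_exact (R := fun x => resnum c (euler x))) D2 D4 => //.
  - exact: kerres_subspace.
  - by move=> *; rewrite eulerL; apply: resnumL.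
  - by move=> x y y'; apply: resnum_fun.
  - move=> x [[[px lx] hx] rx].
    have [y rxy] := resnum_total c0 HA (logcond_euler lx).
    exists y => //; split.
      by exists (euler x); do 2!split => //; [apply: pform_euler | apply: logcond_euler].
    apply: (resnum_homogf rxy); rewrite subrK addrAC; exact: homogf_euler.
  (* A preimage is dz_1/z_1 /\ b for a homogeneous lift [b] of [y]; its own residue is zero because
     every term contains dz_1. *)
  - move=> y /residue_deg_lift[b [pb lb hb rby]].
    have [u lu uE] := logcond_dlog cA c0 HA lb.
    exists u; last exact: resnum_euler_dlog uE rby.
    split; last first.
      apply: (resnum_ext _ (@resnum00 K l c)) => I I0; rewrite ffunE.
      apply: (@mulX_inj _ _ ord0).
      by rewrite /= -uE wedge1_delta (negPf I0) mulr0.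
    split; first split=> //.
      by apply: (vanish_mulX0 uE); apply: pform_wedge1_delta.
    apply/(homogf_mulX _ uE); rewrite addrAC; exact: homogf_wedge1.
(* Multiplication by z_1 is injective, whence the kernel of dimension 0. *)
have E3 : has_dim (OmegaA_deg A p (m - 1)) (0 + d2).
  apply: (has_dim_exact (R := fun x y : form K l.+1 => forall J, y J = 'X_ord0 * x J))
    (has_dim0 _) D2 => //.
  - exact: OmegaA_subspace.
  - by move=> k x x' y y' yx yx' J; rewrite !ffunE yx yx' mulrDr scalerAr.
  - by move=> x y y' yx yx'; apply/ffunP => J; rewrite yx yx'.
  - move=> x Ox; exists [ffun J => 'X_ord0 * x J]; last by move=> J; rewrite ffunE.
    by apply: (kerres2_mulX0 c0 HA _ Ox) => J; rewrite ffunE.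
  - by move=> y; apply: kerres2_divX0.
  - move=> x; split=> [->|[_ x0]].
      split; first exact: (proj1 (OmegaA_subspace _ _ _)).
      by move=> J; rewrite !ffunE mulr0.
    apply/ffunP => J; apply: (@mulX_inj _ _ ord0).
    by rewrite /= -x0 !ffunE mulr0.
rewrite (dimK_eq E1) (dimK_eq E3) (dimK_eq D3) (dimK_eq D4).
by rewrite (has_dim_unique D1 E2).
Qed.

(** * Coefficients of the generating series *)

Lemma dimK_residue0 (K : fieldType) (l : nat) (A : seq 'rV[K]_l.+1) c
    (P : pred {set 'I_l.+1}) m :
  (forall I : {set 'I_l.+1}, ord0 \notin I -> P I) ->
  dimK (residue_deg A c P m) = 0%N.
Proof.
move=> P0; apply: dimK_eq; apply: (has_dim_ext _ (has_dim0 _)) => x; split=> [->|].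
  exact: (proj1 (residue_deg_subspace A c P m)).
(* The lift [u] agrees with 0 on every coefficient without dz_1, so its residue is that of 0. *)
case=> -[u [[Pu _] ru]] _; apply: (resnum_fun ru).
by apply: (resnum_ext _ (@resnum00 K l c)) => I I0; rewrite ffunE Pu ?P0.
Qed.

Lemma dimK_OmegaA0 (K : fieldType) (l : nat) (A : seq 'rV[K]_l) p m :
  (l < p)%N -> dimK (OmegaA_deg A p m) = 0%N.
Proof.
move=> lp; apply: dimK_eq; apply: (has_dim_ext _ (has_dim0 _)) => x; split=> [->|].
  exact: (proj1 (OmegaA_subspace _ _ _)).
case=> -[px _] _; apply/ffunP => I; rewrite px ?ffunE // neq_ltn.
by rewrite (leq_ltn_trans (max_card _)) ?card_ord.
Qed.

(** For p > l the module M^p is zero: a subset of the l + 1 indices that misses 1 has at most l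
    elements. *)
Lemma genME (K : fieldType) (l : nat) (A : seq 'rV[K]_l.+1) c p m :
  genM A c p m = (dimK (Mres_deg A c p m))%:Z.
Proof.
rewrite /genM /hilbM; case: leqP => // lp.
rewrite (@dimK_residue0 _ _ _ _ (fun I => #|I| != p)) // => I I0.
rewrite neq_ltn (leq_trans _ lp) //= ltnS.
by have := max_card (mem (ord0 |: I)); rewrite card_ord cardsU1 I0 add1n.
Qed.

Lemma PhiE (K : fieldType) (l : nat) (A : seq 'rV[K]_l) p m :
  Phi A p m = (dimK (OmegaA_deg A p m))%:Z.
Proof. by rewrite /Phi /hilbOmega; case: leqP => // lp; rewrite dimK_OmegaA0. Qed.

(* dim V = l.+1 ; H = {z_1 = 0} in A with alpha_H = c z_1.
   (x + y) * sum_p P(M^p,x) y^p = x(1-x) * Phi(A;x,y), i.e. the identity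
   sum_p P(M^p,x) y^p = x(1-x)/(x+y) Phi(A;x,y) with the denominator cleared. *)
Theorem mainTheorem2 (K : fieldType) (l : nat) (A : seq 'rV[K]_l.+1)
    (c : K) :
  [char K] =i pred0 ->
  central_arrangement A ->
  c != 0 ->
  c *: delta_mx 0 ord0 \in A ->
  serAdd (serX (genM A c)) (serY (genM A c)) =
  serSub (serX (Phi A)) (serX (serX (Phi A))).
Proof.
move=> _ cA c0 HA; apply: functional_extensionality => p.
apply: functional_extensionality => m.
(* Compare coefficients of x^m y^p: in degree [m - 1] the dimension formula involves M^p in degree
   [m - 1] and M^(p-1) in degree [m]. *)
rewrite /serAdd /serSub /serX !PhiE (dimK_OmegaA p (m - 1) cA c0 HA) subrK.
rewrite -addnA PoszD [RHS]addrC addKr addnC PoszD genME; congr (_ + _).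
case: p => [|p] /=; last by rewrite genME.
(* For p = 0 the y-multiple has no coefficient, and no subset I satisfies #|I| + 1 = 0. *)
by rewrite dimK_residue0.
Qed.
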